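(* Consider the linear inverse problem $y=Ax_0+z$ with $y\in\mathbb R^m$, $x_0\in\mathbb R^n$ (deterministic or random), and $z\sim\mathbb P\in\mathcal P(\mathbb R^m)$, $m>n$. Let the (known) matrix $A\in\mathbb R^{m\times n}$ have full column rank. Let $\mathbb P\in\mathbb B_\varepsilon^{\|\cdot\|_2^2}(\widehat{\mathbb P})$ for some $\varepsilon>0$, where $\widehat{\mathbb P}=\frac1N\sum_{i=1}^N\delta_{\widehat z^{(i)}}$ is the empirical distribution of samples $\widehat z^{(1)},\dots,\widehat z^{(N)}\in\mathbb R^m$. Then the ordinary least squares estimator $\hat x=\arg\min_{x\in\mathbb R^n}\|y-Ax\|_2=(A^\top A)^{-1}A^\top y$ satisfies $$\hat x-x_0\sim\mathbb Q\in\mathbb B_\varepsilon^{\|\cdot\|_2^2\circ A}\big((A^\dagger)_{\#}\widehat{\mathbb P}\big),$$ where $A^\dagger=(A^\top A)^{-1}A^\top$.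
   Context: $\mathcal P(\mathbb R^k)$ is the set of Borel probability distributions on $\mathbb R^k$; $\delta_z$ is the delta distribution at $z$; $(A^\dagger)_{\#}$ is pushforward under $z\mapsto A^\dagger z$. For a cost $c:\mathbb R^k\to\mathbb R_{\ge0}$, $W_c(\mathbb P,\mathbb Q)=\inf_{\gamma\in\Gamma(\mathbb P,\mathbb Q)}\int c(x_1-x_2)\,d\gamma(x_1,x_2)$ with $\Gamma(\mathbb P,\mathbb Q)$ the set of couplings, and $\mathbb B_\varepsilon^c(\mathbb P)=\{\mathbb Q\in\mathcal P(\mathbb R^k):W_c(\mathbb P,\mathbb Q)\le\varepsilon\}$. The cost $\|\cdot\|_2^2\circ A$ on $\mathbb R^n$ is $x\mapsto\|Ax\|_2^2$. *)

(* Defs.v *)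
From HB Require Import structures.
From mathcomp Require Import all_boot all_order all_algebra.
From mathcomp Require Import all_classical all_reals all_analysis.

Set Implicit Arguments.
Unset Strict Implicit.
Unset Printing Implicit Defensive.
Import Order.TTheory GRing.Theory Num.Theory.
Import numFieldNormedType.Exports.

Local Open Scope classical_set_scope.
Local Open Scope ring_scope.

(* Matrices carry the Borel sigma-algebra of their product topology, so
   [probability 'cV[R]_k R] is the set of Borel probability distributions
   on R^k. *)
Section borel_matrix.
Context (R : realType) (m n : nat).
Let G : set (set 'M[R]_(m, n)) := open.

HB.instance Definition _ := @isMeasurable.Build (sigma_display G) 'M[R]_(m, n)
  <<s G >> (@sigma_algebra0 _ setT G) (@sigma_algebraC _ G)
  (@sigma_algebra_bigcup _ setT G).

End borel_matrix.

Lemma continuous_measurable_mx (R : realType) (m n p q : nat)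
    (f : 'M[R]_(m, n) -> 'M[R]_(p, q)) :
  continuous f -> measurable_fun [set: 'M[R]_(m, n)] f.
Proof.
move=> /continuousP cf; apply: (measurability (@open 'M[R]_(p, q))) => //.
move=> _ [B oB <-]; rewrite setTI; apply: sub_sigma_algebra; exact: cf.
Qed.

Lemma mulmx_continuous (R : realType) (m n p : nat) (M : 'M[R]_(m, n)) :
  continuous (mulmx M : 'M[R]_(n, p) -> 'M[R]_(m, p)).
Proof.
move=> x B [P xP PB].
have FF : Filter (nbhs x) by exact: nbhs_filter.
have coord i j : nbhs x [set y : 'M[R]_(n, p) | P i j ((M *m y) i j)].
  have cij : continuous (fun y : 'M[R]_(n, p) => \sum_k M i k * y k j).
    have addc : continuous (fun t : R * R => t.1 + t.2) by exact: add_continuous.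
    apply: (continuous_big addc).
    move=> k _ y; have FFy : Filter (nbhs y) by exact: nbhs_filter.
    apply: (@cvgM _ _ (nbhs y) FFy (fun=> M i k)); first exact: cvg_cst.
    exact: coord_continuous.
  have -> : [set y | P i j ((M *m y) i j)] =
            (fun y : 'M[R]_(n, p) => \sum_k M i k * y k j) @^-1` P i j.
    by apply/seteqP; split=> y /=; rewrite mxE.
  by apply: cij; have := xP i j; rewrite mxE.
have : nbhs x [set y : 'M[R]_(n, p) | forall i j, P i j ((M *m y) i j)].
  apply: (@filter_forall _ _ _ (nbhs x) FF) => i.
  by apply: (@filter_forall _ _ _ (nbhs x) FF) => j; exact: coord.
by apply: (@filterS _ (nbhs x) FF) => y Py; exact: PB.
Qed.

HB.instance Definition _ (R : realType) (m n p : nat) (M : 'M[R]_(m, n)) :=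
  isMeasurableFun.Build _ _ _ _ (mulmx M : 'M[R]_(n, p) -> 'M[R]_(m, p))
    (continuous_measurable_mx (@mulmx_continuous R m n p M)).

Section empirical.
Local Open Scope ereal_scope.
Context d (T : measurableType d) (R : realType).

(* The proof of [0 < N] is an argument so that the instance below can make
   the empirical measure a probability. *)
Definition empirical (N : nat) (hN : (0 < N)%N) (z : 'I_N -> T)
  (B : set T) : \bar R := (N%:R^-1)%R%:E * \sum_(i < N) \d_(z i) B.

Context (N : nat) (hN : (0 < N)%N) (z : 'I_N -> T).

Let empirical0 : empirical hN z set0 = 0.
Proof. by rewrite /empirical big1 ?mule0// => i _; rewrite measure0. Qed.

Let empirical_ge0 B : 0 <= empirical hN z B.
Proof. by rewrite mule_ge0 ?lee_fin ?invr_ge0// sume_ge0. Qed.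

Let empirical_sigma_additive : semi_sigma_additive (empirical hN z).
Proof.
pose mu k : {measure set T -> \bar R} :=
  if insub k is Some i then \d_(z i) else mzero.
have r0 : (0 <= N%:R^-1 :> R)%R by rewrite invr_ge0.
have -> : empirical hN z = mscale (NngNum r0) (msum mu N).
  apply/funext => B; rewrite /empirical /mscale /= /msum; congr (_ * _).
  by apply: eq_bigr => i _; rewrite /mu valK.
exact: measure_semi_sigma_additive.
Qed.

HB.instance Definition _ := isMeasure.Build _ _ _ (empirical hN z)
  empirical0 empirical_ge0 empirical_sigma_additive.

Let empirical_setT : empirical hN z [set: T] = 1.
Proof.
rewrite /empirical (eq_bigr (fun=> 1)); last by move=> i _; rewrite diracT.
rewrite sumEFin sumr_const card_ord -EFinM mulVf//.
by rewrite pnatr_eq0 -lt0n.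
Qed.

HB.instance Definition _ :=
  Measure_isProbability.Build _ _ _ (empirical hN z) empirical_setT.

End empirical.

(* Not [`|x|], which on matrices is the sup norm. *)
Definition norm2 (R : realType) (k : nat) (x : 'cV[R]_k) : R :=
  Num.sqrt (\sum_i x i ord0 ^+ 2).

Section wasserstein.
Local Open Scope ereal_scope.
Context (R : realType) (k : nat).
Implicit Types (c : 'cV[R]_k -> R) (P Q : probability 'cV[R]_k R).

(* Laws are compared on measurable sets only: a [probability] is a function
   on all sets, and its values on the other ones are irrelevant. *)
Definition couplings P Q : set (probability ('cV[R]_k * 'cV[R]_k)%type R) :=
  [set g | (forall B, measurable B -> pushforward g fst B = P B) /\
           (forall B, measurable B -> pushforward g snd B = Q B)].

Definition wasserstein c P Q : \bar R :=
  ereal_inf [set \int[g]_x (c (x.1 - x.2)%R)%:E | g in couplings P Q].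

Definition wasserstein_ball c (eps : R) P : set (probability 'cV[R]_k R) :=
  [set Q | wasserstein c P Q <= eps%:E].

End wasserstein.

Definition has_law (R : realType) (d d' : measure_display)
    (Omega : measurableType d) (T : measurableType d')
    (Pr : probability Omega R) (X : Omega -> T) (Q : probability T R) : Prop :=
  measurable_fun [set: Omega] X /\
  forall B, measurable B -> pushforward Pr X B = Q B.

Section least_squares.
Context (R : realType) (m n : nat).
Implicit Types (A : 'M[R]_(m, n)) (y : 'cV[R]_m).

Definition mxpinv A : 'M[R]_(n, m) := invmx (A^T *m A) *m A^T.

Definition ols_argmin A y : set 'cV[R]_n :=
  [set x | forall x', norm2 (y - A *m x) <= norm2 (y - A *m x')].

End least_squares.

(* Main.v *)
Require Import Defs.
From HB Require Import structures.
From mathcomp Require Import all_boot all_order all_algebra.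
From mathcomp Require Import all_classical all_reals all_analysis.
From mathcomp Require Import measurable_realfun.

(** The estimation error does not depend on [x0]: since
    [mxpinv A *m A = 1%:M], it equals [mxpinv A *m z], so its law is the image
    [Q] of [P] under [mxpinv A]. It remains to see that taking images under
    [mxpinv A] does not increase the optimal transport cost, when the source
    is equipped with the squared norm and the target with the squared norm of
    [A *m x]. Given a coupling of the empirical measure and [P], its image
    under [mxpinv A] on both components couples the images, and pairs at
    difference [v] now cost the squared norm of [A *m (mxpinv A *m v)]. As
    [A *m mxpinv A] is the orthogonal projection onto the column space of [A],
    this is at most the squared norm of [v] ([norm2_projection_le]); integrate
    and take the infimum over couplings ([wasserstein_mulmx_le]).

    The geometric input is one Pythagorean identity, [norm2_residual], which
    also shows that [mxpinv A *m v] is the only minimiser of the least squares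
    objective ([ols_argminE]). Full column rank enters through the
    invertibility of the Gram matrix ([gram_unitmx]). *)

Set Implicit Arguments.
Unset Strict Implicit.
Unset Printing Implicit Defensive.
Import Order.TTheory GRing.Theory Num.Theory.
Import numFieldNormedType.Exports.

Local Open Scope classical_set_scope.
Local Open Scope ring_scope.

Lemma norm2_sqr (R : realType) (k : nat) (v : 'cV[R]_k) :
  norm2 v ^+ 2 = \sum_i v i ord0 ^+ 2.
Proof. by rewrite sqr_sqrtr// sumr_ge0// => i _; rewrite sqr_ge0. Qed.

Lemma norm2_sqr_mulmx (R : realType) (k : nat) (v : 'cV[R]_k) :
  norm2 v ^+ 2 = (v^T *m v) ord0 ord0.
Proof. by rewrite norm2_sqr mxE; apply: eq_bigr => i _; rewrite !mxE. Qed.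

Lemma norm2_ge0 (R : realType) (k : nat) (v : 'cV[R]_k) : 0 <= norm2 v.
Proof. exact: sqrtr_ge0. Qed.

Lemma norm2_sqr_eq0 (R : realType) (k : nat) (v : 'cV[R]_k) :
  norm2 v ^+ 2 = 0 -> v = 0.
Proof.
rewrite norm2_sqr => /eqP; rewrite psumr_eq0 => [/allP v0|i _]; last first.
  exact: sqr_ge0.
apply/colP => i; rewrite mxE; apply/eqP.
by rewrite -sqrf_eq0; apply: v0; rewrite mem_index_enum.
Qed.

Lemma norm2_pythagoras (R : realType) (m n : nat) (A : 'M[R]_(m, n))
    (w : 'cV[R]_n) (r : 'cV[R]_m) :
  A^T *m r = 0 -> norm2 (A *m w + r) ^+ 2 = norm2 (A *m w) ^+ 2 + norm2 r ^+ 2.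
Proof.
move=> Ar0; rewrite !norm2_sqr_mulmx [(_ + _)^T]linearD /= mulmxDl !mulmxDr.
have wr0 : (A *m w)^T *m r = 0 by rewrite trmx_mul -mulmxA Ar0 mulmx0.
have rw0 : r^T *m (A *m w) = 0.
  by rewrite -[LHS]trmxK trmx_mul trmxK wr0 trmx0.
by rewrite wr0 rw0 addr0 add0r mxE.
Qed.

Section full_column_rank.
Context (R : realType) (m n : nat) (A : 'M[R]_(m, n)) (hA : \rank A = n).

Lemma mulmx_full_rank_eq0 (w : 'cV[R]_n) : A *m w = 0 -> w = 0.
Proof.
have freeAT : row_free A^T by rewrite /row_free mxrank_tr hA.
move=> Aw0; apply: trmx_inj; apply: (row_free_inj freeAT).
by rewrite -trmx_mul Aw0 !trmx0 mul0mx.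
Qed.

(** The kernel of the Gram matrix is that of [A], since
    [w^T A^T A w = |A w|^2]. *)
Lemma gram_unitmx : A^T *m A \in unitmx.
Proof.
rewrite -unitmx_tr -row_free_unit -kermx_eq0; apply/eqP/row_matrixP => i.
rewrite row0; set u := row i _; apply: trmx_inj; rewrite trmx0.
have uG0 : u *m (A^T *m A)^T = 0 by rewrite -row_mul mulmx_ker row0.
apply/mulmx_full_rank_eq0/norm2_sqr_eq0.
rewrite norm2_sqr_mulmx trmx_mul trmxK mulmxA -[u *m _ *m A]mulmxA.
by move: uG0; rewrite trmx_mul trmxK => ->; rewrite mul0mx mxE.
Qed.

Lemma mxpinvK : mxpinv A *m A = 1%:M.
Proof. by rewrite /mxpinv -mulmxA mulVmx// gram_unitmx. Qed.

Lemma residual_orthogonal (v : 'cV[R]_m) :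
  A^T *m (v - A *m (mxpinv A *m v)) = 0.
Proof.
by rewrite mulmxBr /mxpinv !mulmxA mulmxV ?gram_unitmx// mul1mx subrr.
Qed.

(** Pythagoras for the residual of [mxpinv A *m v], which is orthogonal to
    the columns of [A]. Both uses of least squares come from it: the first
    summand is the excess over the minimum, and [x := 0] compares [v] with its
    projection. *)
Lemma norm2_residual (v : 'cV[R]_m) (x : 'cV[R]_n) :
  norm2 (v - A *m x) ^+ 2 =
  norm2 (A *m (mxpinv A *m v - x)) ^+ 2 +
  norm2 (v - A *m (mxpinv A *m v)) ^+ 2.
Proof.
rewrite -norm2_pythagoras ?residual_orthogonal//.
by congr (norm2 _ ^+ 2); rewrite mulmxBr [RHS]addrC addrA subrK.
Qed.

(** [A *m mxpinv A] is the orthogonal projection onto the column space of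
    [A], hence a contraction. *)
Lemma norm2_projection_le (v : 'cV[R]_m) :
  norm2 (A *m (mxpinv A *m v)) ^+ 2 <= norm2 v ^+ 2.
Proof.
have := norm2_residual v 0; rewrite mulmx0 !subr0 => ->.
by rewrite lerDl sqr_ge0.
Qed.

Lemma ols_argminE (v : 'cV[R]_m) : ols_argmin A v = [set mxpinv A *m v].
Proof.
apply/seteqP; split=> [x xmin|_ -> x] /=.
  have := xmin (mxpinv A *m v).
  rewrite -ler_sqr ?nnegrE ?norm2_ge0// norm2_residual gerDr => le0.
  apply/esym/subr0_eq/mulmx_full_rank_eq0/norm2_sqr_eq0/eqP.
  by rewrite eq_le le0 sqr_ge0.
by rewrite -ler_sqr ?nnegrE ?norm2_ge0// (norm2_residual v x) lerDr sqr_ge0.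
Qed.

End full_column_rank.

Lemma measurable_coord (R : realType) (k : nat) (i : 'I_k) :
  measurable_fun [set: 'cV[R]_k] (fun v => v i ord0).
Proof.
apply: (measurability _ (RGenOpens.measurableE R)).
move=> _ [_ [a [b ->] <-]]; rewrite setTI; apply: sub_sigma_algebra.
have /continuousP := @coord_continuous R k 1 i ord0; apply.
exact: interval_open.
Qed.

(** Couplings live on the product of the two Borel sigma-algebras. Continuity
    of the cost on pairs gives measurability for the Borel sigma-algebra of the
    product topology, and identifying the two takes second countability. Writing
    the cost as a polynomial in the coordinates, each of which factors through
    a projection, avoids this. *)
Lemma measurable_norm2_sub (R : realType) (k p : nat) (M : 'M[R]_(p, k)) :
  measurable_fun [set: 'cV[R]_k * 'cV[R]_k]
    (fun x => norm2 (M *m (x.1 - x.2)) ^+ 2).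
Proof.
under eq_fun do rewrite norm2_sqr.
apply: measurable_sum => i; apply: measurable_funX.
under eq_fun do rewrite mxE.
apply: measurable_sum => j; apply: measurable_funM; first exact: measurable_cst.
under eq_fun do rewrite !mxE.
apply: measurable_funB; apply: (measurableT_comp (measurable_coord j)).
  exact: measurable_fst.
exact: measurable_snd.
Qed.

Definition mulmx_pair (R : realType) (p k : nat) (M : 'M[R]_(p, k))
  (x : 'cV[R]_k * 'cV[R]_k) : 'cV[R]_p * 'cV[R]_p := (M *m x.1, M *m x.2).

Lemma measurable_mulmx_pair (R : realType) (p k : nat) (M : 'M[R]_(p, k)) :
  measurable_fun setT (mulmx_pair M).
Proof.
have mM := continuous_measurable_mx (@mulmx_continuous R p k 1 M).
by apply: measurable_fun_pair; apply: (measurableT_comp mM);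
  [exact: measurable_fst|exact: measurable_snd].
Qed.

HB.instance Definition _ (R : realType) (p k : nat) (M : 'M[R]_(p, k)) :=
  isMeasurableFun.Build _ _ _ _ (mulmx_pair M) (measurable_mulmx_pair M).

Section wasserstein_mulmx.
Context (R : realType) (p k : nat) (M : 'M[R]_(p, k)).
Context (P Q : probability 'cV[R]_k R).

Let image_law (mu : probability 'cV[R]_k R) : probability 'cV[R]_p R :=
  distribution mu (mulmx M : {mfun 'cV[R]_k >-> 'cV[R]_p}).

Lemma coupling_mulmx g : couplings P Q g ->
  couplings (image_law P) (image_law Q)
    (distribution g (mulmx_pair M : {mfun _ >-> _})).
Proof.
have mM := continuous_measurable_mx (@mulmx_continuous R p k 1 M).
have mpre (B : set 'cV[R]_p) : measurable B -> measurable (mulmx M @^-1` B).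
  by move=> mB; rewrite -[X in measurable X]setTI; exact: (mM measurableT).
move=> [gP gQ]; split=> B mB.
  exact: (gP _ (mpre _ mB)).
exact: (gQ _ (mpre _ mB)).
Qed.

(** The image under [mulmx_pair M] of a coupling is a coupling of the images,
    and by linearity the difference of two image points is the image of their
    difference, so this coupling costs no more than the original one.
    Measurability of the costs is asked on pairs, the form in which they are
    integrated. *)
Lemma wasserstein_mulmx_le (c : 'cV[R]_k -> R) (c' : 'cV[R]_p -> R) :
  measurable_fun [set: 'cV[R]_k * 'cV[R]_k] (fun x => c (x.1 - x.2)) ->
  measurable_fun [set: 'cV[R]_p * 'cV[R]_p] (fun x => c' (x.1 - x.2)) ->
  (forall x, 0 <= c' x) ->
  (forall v, c' (M *m v) <= c v) ->
  (wasserstein c' (image_law P) (image_law Q) <= wasserstein c P Q)%E.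
Proof.
move=> mc mc' c'0 c'c; apply: le_ereal_inf_tmp => _ [g gPQ <-].
apply: ge_ereal_inf; eexists.
  exists (distribution g (mulmx_pair M : {mfun _ >-> _})) => //.
  exact: coupling_mulmx.
rewrite ge0_integral_pushforward//= ?preimage_setT; first last.
- by move=> y _; rewrite lee_fin.
- exact/measurable_EFinP.
apply: ge0_le_integral => //=.
- by move=> x _; rewrite lee_fin.
- apply/measurable_EFinP.
  exact: (measurableT_comp mc' (measurable_mulmx_pair M)).
- exact/measurable_EFinP.
- by move=> x _; rewrite lee_fin -mulmxBr.
Qed.

End wasserstein_mulmx.

Theorem proposition21 (R : realType) (m n N : nat) (hnm : (n < m)%N)
    (A : 'M[R]_(m, n)) (hA : \rank A = n)
    (hN : (0 < N)%N) (zhat : 'I_N -> 'cV[R]_m)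
    (eps : R) (heps : 0 < eps)
    (P : probability 'cV[R]_m R)
    (hP : wasserstein_ball (fun v => norm2 v ^+ 2) eps (empirical R hN zhat) P)
    (d : measure_display) (Omega : measurableType d)
    (Pr : probability Omega R)
    (x0 : Omega -> 'cV[R]_n) (hx0 : measurable_fun [set: Omega] x0)
    (z : Omega -> 'cV[R]_m) (hz : has_law Pr z P)
    (y : Omega -> 'cV[R]_m) (hy : forall w, y w = A *m x0 w + z w)
    (xhat : Omega -> 'cV[R]_n) (hxhat : forall w, ols_argmin A (y w) (xhat w)) :
  (forall v : 'cV[R]_m, ols_argmin A v = [set mxpinv A *m v]) /\
  exists2 Q : probability 'cV[R]_n R,
    has_law Pr (fun w => xhat w - x0 w) Q &
    wasserstein_ball (fun x => norm2 (A *m x) ^+ 2) eps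
      (distribution (empirical R hN zhat)
         (mulmx (mxpinv A) : {mfun 'cV[R]_m >-> 'cV[R]_n})) Q.
Proof.
split; first exact: ols_argminE.
have mpinv := continuous_measurable_mx
  (@mulmx_continuous R n m 1 (mxpinv A)).
have errE : (fun w => xhat w - x0 w) = mulmx (mxpinv A) \o z.
  apply/funext => w /=; have := hxhat w; rewrite ols_argminE// => ->.
  by rewrite hy mulmxDr mulmxA mxpinvK// mul1mx addrC addKr.
have [mz lawz] := hz.
exists (distribution P (mulmx (mxpinv A) : {mfun 'cV[R]_m >-> 'cV[R]_n})).
  rewrite errE; split; first exact: measurableT_comp.
  move=> B mB; apply: lawz.
  by rewrite -[X in measurable X]setTI; exact: (mpinv measurableT).
apply: le_trans hP; apply: wasserstein_mulmx_le.
- by have := measurable_norm2_sub (1%:M : 'M[R]_m);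
    under eq_fun do rewrite mul1mx.
- exact: measurable_norm2_sub.
- by move=> x; exact: sqr_ge0.
- exact: norm2_projection_le.
Qed.
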